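(* Let $\mathcal{X}\in\mathbf{SSS}$ and $x\in\mathcal{X}$. Then $T^*_x\mathcal{X}$ is a real vector space, and the pairing $$\langle-,-\rangle:\ T_x\mathcal{X}\times T^*_x\mathcal{X}\longrightarrow\mathbb{R},\qquad\langle[\gamma],[f]\rangle:=(f\circ\gamma)'(0),$$ is well defined, separates points in each variable, and is homogeneous in the first variable. For a sample-smooth $f:\mathcal{X}\to\mathcal{Y}$ the transpose $df^*_x:T^*_{f(x)}\mathcal{Y}\to T^*_x\mathcal{X}$, $df^*_x[g]:=[g\circ f]$, is well defined and linear, and $\langle df_x(v),[g]\rangle=\langle v,df^*_x[g]\rangle$ for all $v\in T_x\mathcal{X}$ and $[g]\in T^*_{f(x)}\mathcal{Y}$. The pairing is not in general bilinear, because $T_x\mathcal{X}$ need not carry a linear structure making it so: for $\mathcal{X}:=\{(x,y)\in\mathbb{R}^2: xy=0\}\subseteq\mathbb{R}^2$ with the subspace structure and inclusion $\iota$, the map $d\iota_0:T_0\mathcal{X}\to T_0\mathbb{R}^2\cong\mathbb{R}^2$ is injective and its image is the union of the two coordinate axes, which is stable under scalars but is not a linear subspace.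
   Context: **Sample space.** $\Omega=[0,1]^{\mathbb{N}}$; $\mathcal{B}_\Omega$ is the universal completion of its Borel (product) $\sigma$-algebra, i.e. all universally measurable subsets; $\Omega^\Omega$ is the set of all $\mathcal{B}_\Omega$-$\mathcal{B}_\Omega$-measurable self-maps of $\Omega$. **Site.** $\Omega_n:=\mathbb{R}^n\times\Omega$, $n\ge0$. A map $g:\Omega_m\to\mathbb{R}^n$ is mixed-smooth, $g\in\mathcal{C}^\infty_{\mathrm{mix}}(\Omega_m,\mathbb{R}^n)$, if (M1) $g(-,\omega)\in C^\infty(\mathbb{R}^m,\mathbb{R}^n)$ for every $\omega$, and (M2) $g(t,-)$ is $\mathcal{B}_\Omega$-Borel measurable for every $t$. The category $\mathbb{S}$ has objects $\Omega_n$ and morphisms $\mathbb{S}(\Omega_m,\Omega_n)=\{(g,\Phi): g\in\mathcal{C}^\infty_{\mathrm{mix}}(\Omega_m,\mathbb{R}^n),\Phi\in\Omega^\Omega\}$, where $(g,\Phi)(t,\omega)=(g(t,\omega),\Phi(\omega))$. **Sample-smooth spaces.** A sample-smooth space is a set $\mathcal{X}$ with, for each $n\ge0$, a set $\mathcal{X}^{\Omega_n}$ of maps $\Omega_n\to\mathcal{X}$ (plots) containing all constant maps and such that $p\in\mathcal{X}^{\Omega_n}$, $h\in\mathbb{S}(\Omega_m,\Omega_n)$ imply $p\circ h\in\mathcal{X}^{\Omega_m}$. A map $f:\mathcal{X}\to\mathcal{Y}$ is sample-smooth (a morphism of $\mathbf{SSS}$) if $f\circ p\in\mathcal{Y}^{\Omega_n}$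 for all $n$ and $p\in\mathcal{X}^{\Omega_n}$. $\mathbb{R}^k$ carries the plots $\mathcal{C}^\infty_{\mathrm{mix}}(\Omega_n,\mathbb{R}^k)$; $\mathbf{SSS}(\mathbb{R}^k,\mathbb{R}^l)=C^\infty(\mathbb{R}^k,\mathbb{R}^l)$. Subsets carry the plots of the ambient space with values in them (subspace structure). $\mathcal{X}^{\mathbb{R}}=\mathbf{SSS}(\mathbb{R},\mathcal{X})$ is the set of admissible curves. **Tangent and cotangent spaces.** On $\mathcal{X}^{\mathbb{R}}$ let $\gamma\sim\eta$ iff $\gamma(0)=\eta(0)$ and $(f\circ\gamma)'(0)=(f\circ\eta)'(0)$ for all $f\in\mathbf{SSS}(\mathcal{X},\mathbb{R})$. $T_x\mathcal{X}$ is the set of classes $[\gamma]$ with $\gamma(0)=x$; scalars act by $\lambda\cdot[\gamma]=[t\mapsto\gamma(\lambda t)]$. The differential of $f:\mathcal{X}\to\mathcal{Y}$ is $df_x:T_x\mathcal{X}\to T_{f(x)}\mathcal{Y}$, $[\gamma]\mapsto[f\circ\gamma]$. The identification $T_0\mathbb{R}^2\cong\mathbb{R}^2$ is $[\gamma]\mapsto\gamma'(0)$. For $f,g\in\mathbf{SSS}(\mathcal{X},\mathbb{R})$ let $f\sim_x g$ iff $(f\circ\gamma)'(0)=(g\circ\gamma)'(0)$ for every $\gamma\in\mathcal{X}^{\mathbb{R}}$ with $\gamma(0)=x$, and $T^*_x\mathcal{X}:=\mathbf{SSS}(\mathcal{X},\mathbb{R})/\!\sim_x$, with the vector space operations induced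 by pointwise operations. *)

(* Defs.v *)
From HB Require Import structures.
From mathcomp Require Import all_boot all_order all_algebra generic_quotient.
From mathcomp Require Import all_classical all_reals all_analysis measurable_realfun.

Set Implicit Arguments.
Unset Strict Implicit.
Unset Printing Implicit Defensive.

Import Order.TTheory GRing.Theory Num.Theory.
Import numFieldTopology.Exports numFieldNormedType.Exports.

Local Open Scope classical_set_scope.
Local Open Scope ring_scope.
Local Open Scope quotient_scope.

(* The Borel sigma-algebra of a topological space: the library has no canonical
   measurable structure on 'rV[R]_n. *)
Notation borel V := (g_sigma_algebraType (@open V)).

Section sample_space.
Variable R : realType.

Definition Omega : Type := nat -> {u : R | 0 <= u <= 1}.

HB.instance Definition _ := Choice.on Omega.

Fact unit_interval0 : 0 <= (0 : R) <= 1.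
Proof. by rewrite lexx ler01. Qed.

HB.instance Definition _ :=
  isPointed.Build Omega
    (fun=> exist (fun u : R => 0 <= u <= 1) 0 unit_interval0).

Definition cylinders : set (set Omega) :=
  [set C | exists n, exists2 B : set R, measurable B &
    C = [set w | B (val (w n))]].

(* Membership in the completion of the Borel sigma-algebra with respect to every
   probability measure (equivalently, every finite measure). *)
Definition universally_measurable (A : set Omega) : Prop :=
  forall mu : probability (g_sigma_algebraType cylinders) R,
    exists B C : set (g_sigma_algebraType cylinders),
      [/\ measurable B, measurable C, B `<=` A, A `<=` C & mu (C `\` B) = 0%E].

Lemma universally_measurable_set0 : universally_measurable set0.
Proof. by move=> mu; exists set0, set0; split => //; rewrite setD0 measure0. Qed.

Lemma universally_measurableC A :
  universally_measurable A -> universally_measurable (~` A).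
Proof.
move=> mA mu; have [B [C [mB mC BA AC BC0]]] := mA mu.
exists (~` C), (~` B); split; [exact: measurableC | exact: measurableC |
  exact: subsetC | exact: subsetC |].
by rewrite setDE setCK setIC -setDE.
Qed.

Lemma universally_measurable_bigcup (A : (set Omega)^nat) :
  (forall i, universally_measurable (A i)) ->
  universally_measurable (\bigcup_i A i).
Proof.
move=> mA mu.
have /choice[B /choice[C BC]] := fun i => mA i mu.
have mB i : measurable (B i) by case: (BC i).
have mC i : measurable (C i) by case: (BC i).
exists (\bigcup_i B i), (\bigcup_i C i); split.
- exact: bigcupT_measurable.
- exact: bigcupT_measurable.
- by apply: subset_bigcup => i _; case: (BC i).
- by apply: subset_bigcup => i _; case: (BC i).
apply: measure_negligible.
  by apply: measurableD; exact: bigcupT_measurable.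
apply: (@negligibleS _ _ _ _ (\bigcup_i (C i `\` B i))).
  move=> w [[i _ Ciw] nBw]; exists i => //; split => // Biw.
  by apply: nBw; exists i.
apply: negligible_bigcup => i; case: (BC i) => _ _ _ _ BC0.
exists (C i `\` B i); split => //; exact: measurableD.
Qed.

Fact universal_display : measure_display. Proof. exact: default_measure_display. Qed.

(* From here on, measurability on [Omega] is universal measurability; the
   product Borel structure lives on the alias [g_sigma_algebraType cylinders]. *)
HB.instance Definition _ := @isMeasurable.Build universal_display Omega
  universally_measurable universally_measurable_set0 universally_measurableC
  universally_measurable_bigcup.

End sample_space.

Section mixed_smooth.
Variable R : realType.

Definition Omega_ (n : nat) : Type := ('rV[R]_n * Omega R)%type.

(* The domain is finite-dimensional, so the derivative x |-> 'd f x, valued in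
   linear maps, is of class C^k iff all its evaluations x |-> 'd f x v are. *)
Fixpoint Ck (k : nat) (m : nat) (V : normedModType R) (f : 'rV[R]_m -> V)
    : Prop :=
  if k is k'.+1 then
    (forall x, differentiable f x) /\ (forall v, Ck k' (fun x => 'd f x v))
  else continuous f.

Definition smooth (m : nat) (V : normedModType R) (f : 'rV[R]_m -> V) : Prop :=
  forall k, Ck k f.

Definition mixed_smooth (m : nat) (V : normedModType R) (g : Omega_ m -> V)
    : Prop :=
  (forall w : Omega R, smooth (fun t => g (t, w))) /\
  (forall t : 'rV[R]_m,
    measurable_fun setT (fun w : Omega R => g (t, w) : borel V)).

(* The maps (t, w) |-> (g (t, w), Phi w) of the site. *)
Definition site_map (m n : nat) (h : Omega_ m -> Omega_ n) : Prop :=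
  exists (g : Omega_ m -> 'rV[R]_n) (Phi : Omega R -> Omega R),
    [/\ mixed_smooth g, measurable_fun setT Phi &
        h = fun z => (g z, Phi z.2)].

Record sss := SSS {
  sss_car :> Type;
  plot : forall n, set (Omega_ n -> sss_car);
  plot_cst : forall n (x : sss_car), plot (fun _ : Omega_ n => x);
  plot_comp : forall m n (p : Omega_ n -> sss_car) (h : Omega_ m -> Omega_ n),
    plot p -> site_map h -> plot (p \o h) }.

Record mor (X Y : sss) := Mor {
  mor_fun :> X -> Y;
  morP : forall n (p : Omega_ n -> X), plot p -> plot (mor_fun \o p) }.

HB.instance Definition _ X Y := gen_eqMixin (mor X Y).
HB.instance Definition _ X Y := gen_choiceMixin (mor X Y).

End mixed_smooth.

Section smooth_theory.
Variable R : realType.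
Implicit Types V W : normedModType R.

Lemma Ck_continuous k m V (f : 'rV[R]_m -> V) : Ck k f -> continuous f.
Proof.
by case: k => [//|k] [df _] x; exact/differentiable_continuous/df.
Qed.

Lemma CkS k m V (f : 'rV[R]_m -> V) : Ck k.+1 f -> Ck k f.
Proof.
elim: k f => [|k IH] f; first exact: Ck_continuous.
by move=> [df Ckdf]; split => // v; apply: IH; exact: Ckdf.
Qed.

Lemma Ck_cst k m V (a : V) : Ck k (fun _ : 'rV[R]_m => a).
Proof.
elim: k a => [|k IH] a; first exact: cst_continuous.
split=> [x|v]; first exact: differentiable_cst.
rewrite [X in Ck k X](_ : _ = fun=> 0); first exact: IH.
by apply/funext => x; rewrite (diff_cst a x).
Qed.

Lemma Ck_lin k m V W (L : {linear V -> W}) (f : 'rV[R]_m -> V) :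
  continuous L -> Ck k f -> Ck k (L \o f).
Proof.
move=> cL; elim: k f => [|k IH] f.
  by move=> cf x; apply: continuous_comp; [exact: cf | exact: cL].
move=> [df Ckdf]; split=> [x|v].
  by apply: differentiable_comp => //; exact: linear_differentiable.
rewrite [X in Ck k X](_ : _ = L \o (fun x => 'd f x v)).
  exact/IH/Ckdf.
apply/funext => x; rewrite diff_comp//=; first by rewrite diff_lin.
exact: linear_differentiable.
Qed.

Lemma Ck_linear k m V (L : {linear 'rV[R]_m -> V}) : continuous L -> Ck k L.
Proof.
move=> cL; case: k => [//|k]; split=> [x|v]; first exact: linear_differentiable.
rewrite [X in Ck k X](_ : _ = fun=> L v); first exact: Ck_cst.
by apply/funext => x; rewrite diff_lin.
Qed.

Lemma Ck_add k m V (f g : 'rV[R]_m -> V) :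
  Ck k f -> Ck k g -> Ck k (fun x => f x + g x).
Proof.
elim: k f g => [|k IH] f g; first by move=> cf cg x; apply: (@continuousD _ _ _ f g); [exact: cf|exact: cg].
move=> [df Ckdf] [dg Ckdg]; split=> [x|v]; first exact: differentiableD.
rewrite [X in Ck k X](_ : _ = fun x => 'd f x v + 'd g x v).
  by apply: IH; [exact: Ckdf | exact: Ckdg].
by apply/funext => x; rewrite (@diffD _ _ _ f g).
Qed.

Lemma scale_differentiable m V (a : 'rV[R]_m -> R) (f : 'rV[R]_m -> V) x :
  differentiable a x -> differentiable f x ->
  differentiable (fun y => a y *: f y) x /\
  forall v, 'd (fun y => a y *: f y) x v = a x *: 'd f x v + 'd a x v *: f x.
Proof.
move=> da df.
have bil : bilinear_for (GRing.Scale.Law.clone _ _ *:%R _)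
   (GRing.Scale.Law.clone _ _ *:%R _) (fun (b : R) (u : V) => b *: u).
  split=> [u|b] c y z /=; first by rewrite scalerDl scalerA.
  by rewrite scalerDr !scalerA mulrC.
pose bM := bilinear_isBilinear.Build R R V V _ _ (fun b u => b *: u) bil.
pose b : {bilinear R -> V -> V} := HB.pack (fun (b : R) (u : V) => b *: u) bM.
have cb : continuous (fun p : R * V => b p.1 p.2).
  by move=> p; exact: scale_continuous.
have dp : differentiable (fun y => (a y, f y)) x by exact: differentiable_pair.
have db := differentiable_bilin (a x, f x) cb.
have E : (fun y => a y *: f y) = (fun p => b p.1 p.2) \o (fun y => (a y, f y)).
  by [].
split=> [|v]; first by rewrite E; exact: differentiable_comp.
rewrite E diff_comp// -[LHS]/('d (fun p => b p.1 p.2) (a x, f x) _).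
by rewrite (diff_bilin (f := b) (a x, f x) cb) diff_pair.
Qed.

Lemma Ck_scale k m V (a : 'rV[R]_m -> R) (f : 'rV[R]_m -> V) :
  Ck k a -> Ck k f -> Ck k (fun x => a x *: f x).
Proof.
elim: k V a f => [|k IH] V a f.
  by move=> ca cf x; apply: (@continuousZ _ _ _ a f); [exact: ca | exact: cf].
move=> Ca Cf; have [[da Ckda] [df Ckdf]] := (Ca, Cf).
split=> [x|v]; first by case: (scale_differentiable (da x) (df x)).
rewrite [X in Ck k X](_ : _ = fun x => a x *: 'd f x v + 'd a x v *: f x).
  apply: Ck_add; apply: IH; [exact: CkS|exact: Ckdf|exact: Ckda|exact: CkS].
by apply/funext => x; case: (scale_differentiable (da x) (df x)) => _ ->.
Qed.

Lemma Ck_sum k m V n (F : 'I_n -> 'rV[R]_m -> V) :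
  (forall i, Ck k (F i)) -> Ck k (fun x => \sum_(i < n) F i x).
Proof.
elim: n F => [|n IH] F CF.
  rewrite [X in Ck k X](_ : _ = fun=> 0); first exact: Ck_cst.
  by apply/funext => x; rewrite big_ord0.
rewrite [X in Ck k X](_ : _ = fun x =>
  \sum_(i < n) F (widen_ord (leqnSn n) i) x + F ord_max x).
  by apply: Ck_add; [apply: IH => i; exact: CF | exact: CF].
by apply/funext => x; rewrite big_ord_recr.
Qed.

Definition coord_lin m (i : 'I_m) : 'rV[R]_m -> R := fun v => v 0 i.

Fact coord_lin_linear m i : linear (@coord_lin m i).
Proof. by move=> a u v; rewrite /coord_lin !mxE. Qed.

HB.instance Definition _ m i :=
  GRing.isLinear.Build R 'rV[R]_m R *:%R (@coord_lin m i) (@coord_lin_linear m i).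

Lemma coord_lin_continuous m i : continuous (@coord_lin m i).
Proof. exact: coord_continuous. Qed.

Lemma Ck_comp k m n V (f : 'rV[R]_n -> V) (g : 'rV[R]_m -> 'rV[R]_n) :
  Ck k f -> Ck k g -> Ck k (f \o g).
Proof.
elim: k V f g => [|k IH] V f g.
  by move=> cf cg x; apply: continuous_comp; [exact: cg | exact: cf].
move=> Cf Cg; have [[df Ckdf] [dg Ckdg]] := (Cf, Cg).
split=> [x|v]; first exact: differentiable_comp.
rewrite [X in Ck k X](_ : _ = fun x =>
  \sum_(i < n) coord_lin i ('d g x v) *: 'd f (g x) (delta_mx 0 i)).
  apply: Ck_sum => i; apply: Ck_scale.
    by apply: (@Ck_lin k m _ _ (coord_lin i) (fun x => 'd g x v));
      [exact: coord_lin_continuous | exact: Ckdg].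
  apply: (IH _ (fun y => 'd f y (delta_mx 0 i)) g); [exact: Ckdf|exact: CkS].
apply/funext => x; rewrite diff_comp//= [in LHS](row_sum_delta ('d g x v)).
by rewrite linear_sum; apply: eq_bigr => i _; rewrite linearZ.
Qed.

End smooth_theory.

Section measurability.
Variable R : realType.
Implicit Types V W : normedModType R.

Lemma measurable_borel V (f : Omega R -> V) :
  (forall U : set V, open U -> measurable (f @^-1` U)) ->
  measurable_fun setT (f : Omega R -> borel V).
Proof.
move=> mf; apply: (@measurability _ _ _ (borel V) _ _ (@open V)) => //.
by move=> _ [U oU <-]; rewrite setTI; exact: mf.
Qed.

Lemma measurable_borelP V (f : Omega R -> V) (U : set V) :
  measurable_fun setT (f : Omega R -> borel V) -> open U ->
  measurable (f @^-1` U).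
Proof.
move=> mf oU; rewrite -[X in measurable X]setTI; apply: mf => //.
exact: sub_sigma_algebra.
Qed.

Lemma measurable_borel_comp V W (f : Omega R -> V) (h : V -> W) :
  continuous h -> measurable_fun setT (f : Omega R -> borel V) ->
  measurable_fun setT (h \o f : Omega R -> borel W).
Proof.
move=> ch mf; apply: measurable_borel => U oU; rewrite comp_preimage.
by apply: measurable_borelP => //; apply: open_comp => // x _; exact: ch.
Qed.

Lemma borel_measurable_fun (f : Omega R -> R) :
  measurable_fun setT (f : Omega R -> borel R) <-> measurable_fun setT f.
Proof.
split=> mf.
  apply: (@measurability _ _ _ _ _ _ (@RGenOpens.G R)); first exact: RGenOpens.measurableE.
  move=> _ [_ [x [y ->]] <-]; rewrite setTI; apply: (@measurable_borelP R f _ mf).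
  exact: interval_open.
apply: measurable_borel => U oU; rewrite -[X in measurable X]setTI.
by apply: mf => //; exact: open_measurable.
Qed.

Lemma measurable_borel_lim V (F : nat -> Omega R -> V) (f : Omega R -> V) :
  (forall k, measurable_fun setT (F k : Omega R -> borel V)) ->
  (forall w, F ^~ w @ \oo --> f w) ->
  measurable_fun setT (f : Omega R -> borel V).
Proof.
move=> mF Ff; apply: measurable_borel => U oU.
pose D j : set V := [set x | forall y, `|x - y| < j.+1%:R^-1 -> U y].
have oD j : open (~` D j).
  rewrite openE => x /=; rewrite /D /= => /existsNP[y /not_implyP[xy nUy]].
  rewrite /interior; have e0 : 0 < j.+1%:R^-1 - `|x - y| by rewrite subr_gt0.
  apply/nbhs_normP; exists (j.+1%:R^-1 - `|x - y|) => //= z /= xz.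
  apply/existsNP; exists y; apply/not_implyP; split => //.
  rewrite -[z - y](subrKA x) (le_lt_trans (ler_normD _ _))// distrC.
  by rewrite -ltrBrDr.
rewrite [X in measurable X](_ : _ = \bigcup_j \bigcup_K \bigcap_(k in [set k | (K <= k)%N])
   (F k @^-1` D j)).
  apply: bigcupT_measurable => j; apply: bigcupT_measurable => K.
  apply: bigcap_measurableType => k _.
  rewrite -[D j]setCK preimage_setC; apply: measurableC.
  exact: (measurable_borelP (mF k) (oD j)).
apply/seteqP; split => w /=.
  move=> Ufw; move: oU; rewrite openE => /(_ _ Ufw) /nbhs_normP[e /= e0 eU].
  have e20 : 0 < e / 2 by rewrite divr_gt0.
  have [j _ /(_ _ (leqnn _))/= je] := near_infty_natSinv_lt (PosNum e20).
  have j0 : 0 < j.+1%:R^-1 :> R by rewrite invr_gt0.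
  have /cvgrPdist_lt/(_ _ j0)[K _ HK] := Ff w.
  exists j => //; exists K => // k /= Kk y Fy; apply: eU => /=.
  rewrite -[f w - y](subrKA (F k w)) (le_lt_trans (ler_normD _ _))//.
  rewrite [e]splitr ltrD//; first exact: lt_trans (HK _ Kk) je.
  exact: lt_trans Fy je.
move=> [j _ [K _ HK]].
have j0 : 0 < j.+1%:R^-1 :> R by rewrite invr_gt0.
have /cvgrPdist_lt/(_ _ j0)[K' _ HK'] := Ff w.
have := HK (maxn K K') (leq_maxl _ _); apply.
by rewrite distrC; apply: HK' => /=; exact: leq_maxr.
Qed.

Definition grid n k (v : 'rV[R]_n) : 'rV[R]_n :=
  \row_i ((Num.floor (k.+1%:R * v 0 i))%:~R / k.+1%:R).

Lemma grid_cvg n (v : 'rV[R]_n) : grid k v @[k --> \oo] --> v.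
Proof.
apply/cvgrPdist_lt => e e0.
have [K _ HK] := near_infty_natSinv_lt (PosNum e0).
exists K => // k /= /HK/= ke.
have ik : forall i, `|v 0 i - grid k v 0 i| <= k.+1%:R^-1.
  move=> i; rewrite mxE; have /andP[fl fu] := floor_itv (k.+1%:R * v 0 i).
  have -> : v 0 i - (Num.floor (k.+1%:R * v 0 i))%:~R / k.+1%:R =
     (k.+1%:R * v 0 i - (Num.floor (k.+1%:R * v 0 i))%:~R) / k.+1%:R.
    by rewrite mulrBl mulrAC mulfV ?mul1r ?pnatr_eq0.
  rewrite normrM normfV (ger0_norm (ler0n _ _)) ler_piMl ?invr_ge0//.
  rewrite ger0_norm ?subr_ge0// lerBlDl ltW//.
  by rewrite intrD in fu.
rewrite (le_lt_trans _ ke)// [leLHS]mx_normrE; apply/bigmax_leP; split => //=.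
by move=> [i j] _ /=; rewrite ord1 !mxE; have := ik j; rewrite mxE.
Qed.

Lemma measurable_caratheodory n V (p : Omega_ R n -> V) (g : Omega R -> 'rV[R]_n)
    (Phi : Omega R -> Omega R) :
  mixed_smooth p -> measurable_fun setT (g : Omega R -> borel 'rV[R]_n) ->
  measurable_fun setT Phi ->
  measurable_fun setT (fun w => p (g w, Phi w) : borel V).
Proof.
move=> [sp mp] mg mPhi.
apply: (@measurable_borel_lim _ (fun k w => p (grid k (g w), Phi w))); last first.
  move=> w; have cp : continuous (fun t => p (t, Phi w)).
    exact: (Ck_continuous (sp (Phi w) 0)).
  have := cvg_comp (fun k => grid k (g w)) (fun t => p (t, Phi w)) (@grid_cvg _ (g w)) (cp (g w)). exact.
move=> k; apply: measurable_borel => U oU.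
pose c (z : 'rV[int]_n) : 'rV[R]_n := \row_i ((z 0 i)%:~R / k.+1%:R).
rewrite [X in measurable X](_ : _ = \bigcup_(z : 'rV[int]_n)
   ((\bigcap_(i in [set: 'I_n])
       [set w | Num.floor (k.+1%:R * g w 0 i) = z 0 i]) `&`
    ((fun w => p (c z, w)) \o Phi) @^-1` U)); last first.
  apply/seteqP; split => w /=.
    move=> Uw; exists (\row_i Num.floor (k.+1%:R * g w 0 i)) => //; split => /=.
      by move=> i _ /=; rewrite mxE.
    by congr (U (p (_, _))): Uw; apply/rowP => i; rewrite !mxE.
  move=> [z _ [/= zw]]; congr (U (p (_, _))).
  by apply/rowP => i; rewrite !mxE zw.
apply: countable_bigcupT_measurable => // z; apply: measurableI.
  apply: fin_bigcap_measurable; first exact: finite_finset.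
  move=> i _.
  have ci (a : R) : measurable [set w | k.+1%:R * g w 0 i < a].
    apply: (@measurable_borelP _ g [set v | k.+1%:R * v 0 i < a]) => //.
    apply: (@open_comp _ _ (fun v : 'rV[R]_n => k.+1%:R * v 0 i) [set x | x < a]).
      move=> v _; apply: (@continuous_comp _ _ _ (fun v : 'rV[R]_n => v 0 i)
        ( *%R k.+1%:R)); [exact: coord_continuous | exact: mulrl_continuous].
    exact: open_lt.
  rewrite [X in measurable X](_ : _ =
     [set w | k.+1%:R * g w 0 i < (z 0 i + 1)%:~R] `\`
     [set w | k.+1%:R * g w 0 i < (z 0 i)%:~R]).
    exact: measurableD.
  apply/seteqP; split => w /=.
    by move/eqP; rewrite floor_eq => /andP[zl zu]; split => //; apply/negP; rewrite -leNgt.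
  by move=> [zu /negP]; rewrite -leNgt => zl; apply/eqP; rewrite floor_eq zl.
apply: measurable_borelP => //.
exact: (measurable_comp measurableT _ (mp (c z)) mPhi).
Qed.

End measurability.

Section standard_spaces.
Variable R : realType.

Lemma smooth_mixed m (V : normedModType R) (f : 'rV[R]_m -> V) :
  smooth f -> mixed_smooth (fun z : Omega_ R m => f z.1).
Proof. by move=> sf; split => // t; exact: (@measurable_cst _ _ _ (borel V) _ (f t)). Qed.

Lemma mixed_smooth_cst m (V : normedModType R) (a : V) :
  mixed_smooth (fun _ : Omega_ R m => a).
Proof. by apply: (smooth_mixed (f := fun=> a)) => k; exact: Ck_cst. Qed.

Lemma mixed_smooth_lin m (V W : normedModType R) (L : {linear V -> W})
    (g : Omega_ R m -> V) :
  continuous L -> mixed_smooth g -> mixed_smooth (L \o g).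
Proof.
move=> cL [sg mg]; split => [w k|t]; first exact/(Ck_lin cL)/sg.
exact: measurable_borel_comp cL (mg t).
Qed.

Lemma mixed_smooth_comp m n (V : normedModType R) (p : Omega_ R n -> V)
    (h : Omega_ R m -> Omega_ R n) :
  mixed_smooth p -> site_map h -> mixed_smooth (p \o h).
Proof.
move=> mp [g [Phi [mg mPhi ->]]]; split => [w k|t].
  apply: (@Ck_comp _ k m n V (fun t => p (t, Phi w)) (fun t => g (t, w))).
  - exact: mp.1.
  - exact: mg.1.
exact: (measurable_caratheodory mp (mg.2 t) mPhi).
Qed.

(* The standard structure; it is used for V = 'rV[R]_k and for the real line,
   which is taken to be R itself rather than 'rV[R]_1. *)
Definition std (V : normedModType R) : sss R :=
  @SSS R V (fun n => [set g : Omega_ R n -> V | mixed_smooth g])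
    (fun n => @mixed_smooth_cst n V)
    (fun m n => @mixed_smooth_comp m n V).

Section subspace.
Variables (X : sss R) (A : set X).

Definition sub_plot n : set (Omega_ R n -> {x : X | A x}) :=
  [set p | plot (fun z => sval (p z))].

Fact sub_plot_cst n (x : {x : X | A x}) : @sub_plot n (fun=> x).
Proof. exact: plot_cst. Qed.

Fact sub_plot_comp m n (p : Omega_ R n -> {x : X | A x})
    (h : Omega_ R m -> Omega_ R n) :
  sub_plot p -> site_map h -> sub_plot (p \o h).
Proof. exact: plot_comp. Qed.

Definition sub_sss : sss R := SSS sub_plot_cst sub_plot_comp.

Definition incl : mor sub_sss X := @Mor R sub_sss X sval (fun n p pp => pp).

End subspace.

Section morphisms.
Variables X Y Z : sss R.

Lemma mor_ext (f g : mor X Y) : f =1 g -> f = g.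
Proof.
case: f g => [f fP] [g gP] /= /funext fg; subst g.
by congr Mor; exact: Prop_irrelevance.
Qed.

Fact mor_compP (g : mor Y Z) (f : mor X Y) n (p : Omega_ R n -> X) :
  plot p -> plot ((g \o f) \o p).
Proof. by move=> pp; exact/(morP g (p := f \o p))/morP. Qed.

Definition mor_comp (g : mor Y Z) (f : mor X Y) : mor X Z :=
  Mor (mor_compP g f).

End morphisms.

Definition curve (X : sss R) : Type := mor (std R) X.

Definition smfun (X : sss R) : Type := mor X (std R).

HB.instance Definition _ X := Choice.on (smfun X).

Section smfun_lmodule.
Variable X : sss R.
Implicit Types f g : smfun X.

Fact smfun_zeroP n (p : Omega_ R n -> X) :
  plot p -> plot ((fun=> 0 : std R) \o p).
Proof. by move=> _; exact: mixed_smooth_cst. Qed.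

Fact smfun_addP f g n (p : Omega_ R n -> X) :
  plot p -> plot ((fun x => (f x : R) + g x : std R) \o p).
Proof.
move=> pp; have [[sf mf] [sg mg]] := (morP f pp, morP g pp).
split => [w k|t]; first by apply: Ck_add; [exact: sf | exact: sg].
apply/borel_measurable_fun.
by apply: measurable_funD; apply/borel_measurable_fun; [exact: mf|exact: mg].
Qed.

Fact smfun_scaleP (a : R) f n (p : Omega_ R n -> X) :
  plot p -> plot ((fun x => a * (f x : R) : std R) \o p).
Proof.
move=> pp; have [sf mf] := morP f pp.
split => [w k|t].
  apply: (@Ck_scale _ k n R (fun=> a) (fun t => f (p (t, w)))).
    exact: Ck_cst.
  exact: sf.
apply/borel_measurable_fun.
by apply: measurable_funM => //; apply/borel_measurable_fun; exact: mf.
Qed.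

Definition smfun_zero : smfun X := Mor smfun_zeroP.
Definition smfun_add f g : smfun X := Mor (smfun_addP f g).
Definition smfun_scale a f : smfun X := Mor (smfun_scaleP a f).
Definition smfun_opp f : smfun X := smfun_scale (-1) f.

Fact smfun_addA : associative smfun_add.
Proof. by move=> f g h; apply: mor_ext => x /=; rewrite addrA. Qed.
Fact smfun_addC : commutative smfun_add.
Proof. by move=> f g; apply: mor_ext => x /=; rewrite addrC. Qed.
Fact smfun_add0 : left_id smfun_zero smfun_add.
Proof. by move=> f; apply: mor_ext => x /=; rewrite add0r. Qed.
Fact smfun_addN : left_inverse smfun_zero smfun_opp smfun_add.
Proof. by move=> f; apply: mor_ext => x /=; rewrite mulN1r addNr. Qed.

HB.instance Definition _ :=
  GRing.isZmodule.Build (smfun X) smfun_addA smfun_addC smfun_add0 smfun_addN.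

Fact smfun_scaleA a b f :
  smfun_scale a (smfun_scale b f) = smfun_scale (a * b) f.
Proof. by apply: mor_ext => x /=; rewrite mulrA. Qed.
Fact smfun_scale1 : left_id 1 smfun_scale.
Proof. by move=> f; apply: mor_ext => x /=; rewrite mul1r. Qed.
Fact smfun_scaleDr : right_distributive smfun_scale +%R.
Proof. by move=> a f g; apply: mor_ext => x /=; rewrite mulrDr. Qed.
Fact smfun_scaleDl f : {morph smfun_scale^~ f : a b / a + b}.
Proof. by move=> a b; apply: mor_ext => x /=; rewrite mulrDl. Qed.

HB.instance Definition _ := GRing.Zmodule_isLmodule.Build R (smfun X)
  smfun_scaleA smfun_scale1 smfun_scaleDr smfun_scaleDl.

End smfun_lmodule.

Lemma smfun_addE (X : sss R) (f g : smfun X) (x : X) :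
  ((f + g : smfun X) x : R) = (f x : R) + g x.
Proof. by []. Qed.

Lemma smfun_scaleE (X : sss R) (a : R) (f : smfun X) (x : X) :
  ((a *: f : smfun X) x : R) = a * (f x : R).
Proof. by []. Qed.

Lemma curve_differentiable (V : normedModType R) (c : curve (std V)) (t : R) :
  differentiable (c : R -> V) t.
Proof.
have sq : mixed_smooth (coord_lin (R := R) (0 : 'I_1) \o fst : Omega_ R 1 -> R).
  by apply: smooth_mixed => k; apply: Ck_linear; exact: coord_lin_continuous.
have [sc _] := morP c (p := _ : Omega_ R 1 -> std R) sq.
have [dc _] := sc point 1%N.
have -> : (c : R -> V) =
    (fun s : 'rV[R]_1 => c (s 0 0)) \o (fun a : R => a *: const_mx 1).
  by apply/funext => a /=; rewrite !mxE mulr1.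
apply: differentiable_comp; last exact: dc.
exact: differentiableZl.
Qed.

Lemma curve_lin (V W : normedModType R) (c : curve (std V)) (L : {linear V -> W}) :
  continuous L -> derive1 (L \o c : R -> W) 0 = L (derive1 (c : R -> V) 0).
Proof.
move=> cL; have dc := curve_differentiable c 0.
have dL : differentiable L (c 0) by exact: linear_differentiable.
rewrite (derive1E' (differentiable_comp dc dL)) (derive1E' dc).
by rewrite (diff_comp dc dL) /= (diff_lin _ cL).
Qed.

Lemma curve_rescale (V : normedModType R) (c : curve (std V)) (a : R) :
  derive1 (fun t : R => c (a * t) : V) 0 = a *: derive1 (c : R -> V) 0.
Proof.
pose h : R -> R := *:%R a.
have dh : is_diff (0 : R) h h by exact: is_diff_scaler.
have da : differentiable h (0 : R) by exact: ex_diff.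
have dc t : differentiable (c : R -> V) t by exact: curve_differentiable.
have := derive1E' (differentiable_comp da (dc (h 0))).
rewrite (diff_comp da (dc (h 0))) /= diff_val => ->.
by rewrite (derive1E' (dc 0)) /h scaler0 linearZ.
Qed.

End standard_spaces.

Section tangent.
Variable R : realType.

Definition curve_equiv (X : sss R) (c d : curve X) : Prop :=
  c 0 = d 0 /\
  forall f : smfun X, derive1 (f \o c : R -> R) 0 = derive1 (f \o d : R -> R) 0.

(* [curve_equiv] fixes the base point, so the classes of curves [c] with
   [c 0 = x] do not change when only such curves are considered. *)
Record curve_at (X : sss R) (x : X) := CurveAt {
  curve_at_curve :> mor (std R) X;
  curve_at0 : curve_at_curve 0 = x }.

HB.instance Definition _ X x := gen_eqMixin (@curve_at X x).
HB.instance Definition _ X x := gen_choiceMixin (@curve_at X x).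

Section tangent_at.
Variables (X : sss R) (x : X).

Definition tangent_rel : rel (curve_at x) := fun c d => `[< curve_equiv c d >].

Fact tangent_rel_refl : reflexive tangent_rel.
Proof. by move=> c; apply/asboolP; split. Qed.

Fact tangent_rel_sym : symmetric tangent_rel.
Proof.
by move=> c d; apply/asbool_equiv_eq; split=> -[e0 e]; split => // f; rewrite e.
Qed.

Fact tangent_rel_trans : transitive tangent_rel.
Proof.
move=> c d e /asboolP[dc0 dc] /asboolP[ce0 ce]; apply/asboolP; split.
  by rewrite dc0.
by move=> f; rewrite dc.
Qed.

Canonical tangent_equiv :=
  EquivRel tangent_rel tangent_rel_refl tangent_rel_sym tangent_rel_trans.

Definition tangent : Type := {eq_quot tangent_rel}.

HB.instance Definition _ : EqQuotient _ tangent_rel tangent :=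
  EqQuotient.on tangent.
HB.instance Definition _ := Choice.on tangent.

Definition tclass (c : curve_at x) : tangent := \pi_tangent c.

Lemma tclassP (c d : curve_at x) : curve_equiv c d <-> tclass c = tclass d.
Proof.
split=> [cd|/eqmodP/asboolP //].
by apply/eqmodP/asboolP.
Qed.

Definition cotangent_rel : rel (smfun X) := fun f g =>
  `[< forall c : curve X, c 0 = x ->
      derive1 (f \o c : R -> R) 0 = derive1 (g \o c : R -> R) 0 >].

Fact cotangent_rel_refl : reflexive cotangent_rel.
Proof. by move=> f; apply/asboolP. Qed.

Fact cotangent_rel_sym : symmetric cotangent_rel.
Proof.
by move=> f g; apply/asbool_equiv_eq; split=> fg c cx; rewrite fg.
Qed.

Fact cotangent_rel_trans : transitive cotangent_rel.
Proof.
move=> f g h /asboolP gf /asboolP fh; apply/asboolP => c cx.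
by rewrite gf// fh.
Qed.

Canonical cotangent_equiv := EquivRel cotangent_rel
  cotangent_rel_refl cotangent_rel_sym cotangent_rel_trans.

Definition cotangent : Type := {eq_quot cotangent_rel}.

HB.instance Definition _ : EqQuotient _ cotangent_rel cotangent :=
  EqQuotient.on cotangent.
HB.instance Definition _ := Choice.on cotangent.

Definition cotclass (f : smfun X) : cotangent := \pi_cotangent f.

(* [GRing.Lmodule R T] is the type of R-vector space structures on the type [T].
   The class map being linear says that addition and scaling in [L] are the ones
   induced by pointwise addition and scaling of functions. *)
Definition induced_lmodule (L : GRing.Lmodule R cotangent) : Prop :=
  linear (cotclass : smfun X -> GRing.Lmodule.Pack L).

(* [pairing], [tscale], [differential], [transpose] and [velocity] evaluate on
   the canonical representatives [repr]; independence of the representative is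
   the content of equations such as [tscaleE]. *)
Definition pairing (v : tangent) (phi : cotangent) : R :=
  derive1 (repr phi \o repr v : R -> R) 0.

Definition rescale (a : R) : mor (std R) (std R) :=
  smfun_scale a (@Mor R (std R) (std R) (fun t => t) (fun n p pp => pp)).

Fact rescale_curve_at0 (a : R) (c : curve_at x) : mor_comp c (rescale a) 0 = x.
Proof. by rewrite /= mulr0 curve_at0. Qed.

Definition rescale_curve (a : R) (c : curve_at x) : curve_at x :=
  CurveAt (rescale_curve_at0 a c).

Definition tscale (a : R) (v : tangent) : tangent :=
  tclass (rescale_curve a (repr v)).

Lemma tclass_repr (v : tangent) : tclass (repr v) = v.
Proof. exact: reprK. Qed.

Lemma tscaleE (a : R) (c : curve_at x) :
  tscale a (tclass c) = tclass (rescale_curve a c).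
Proof.
apply/tclassP; split => [|f]; first by rewrite !curve_at0.
have [_ /(_ f) rc] : curve_equiv (repr (tclass c)) c.
  by apply/tclassP; rewrite tclass_repr.
have E (d : curve_at x) : derive1 (f \o rescale_curve a d : R -> R) 0 =
    a *: derive1 (f \o d : R -> R) 0.
  exact: (@curve_rescale R R (mor_comp f d) a).
by rewrite !E rc.
Qed.

End tangent_at.

Section differential.
Variables (X Y : sss R) (f : mor X Y) (x : X).

Fact push_curve_at0 (c : curve_at x) : mor_comp f c 0 = f x.
Proof. by rewrite /= curve_at0. Qed.

Definition push_curve (c : curve_at x) : curve_at (f x) :=
  CurveAt (push_curve_at0 c).

Definition differential (v : tangent x) : tangent (f x) :=
  tclass (push_curve (repr v)).

Lemma differentialE (c : curve_at x) :
  differential (tclass c) = tclass (push_curve c).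
Proof.
have [_ rc] : curve_equiv (repr (tclass c)) c.
  by apply/tclassP; rewrite tclass_repr.
apply/tclassP; split=> [|g]; first by rewrite !curve_at0.
exact: (rc (mor_comp g f)).
Qed.

Definition pull (g : smfun Y) : smfun X := mor_comp g f.

Definition transpose (phi : cotangent (f x)) : cotangent x :=
  cotclass x (pull (repr phi)).

End differential.

Definition velocity (n : nat) (a : std 'rV[R]_n) (v : tangent a) : 'rV[R]_n :=
  derive1 (repr v : R -> 'rV[R]_n) 0.

Definition coord_fun (n : nat) (i : 'I_n) : smfun (std 'rV[R]_n) :=
  @Mor R (std 'rV[R]_n) (std R) (coord_lin i)
    (fun m p pp => mixed_smooth_lin (@coord_lin_continuous R n i) pp).

Lemma velocityE n (a : std 'rV[R]_n) (c : curve_at a) :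
  velocity (tclass c) = derive1 (c : R -> 'rV[R]_n) 0.
Proof.
have [_ rc] : curve_equiv (repr (tclass c)) c.
  by apply/tclassP; rewrite tclass_repr.
apply/rowP => i; have := rc (coord_fun i).
by rewrite !(curve_lin _ (@coord_lin_continuous R n i)).
Qed.

Fact line_plot n (a v : 'rV[R]_n) m (p : Omega_ R m -> std R) :
  plot p -> plot ((fun t : std R => a + (t : R) *: v : std 'rV[R]_n) \o p).
Proof.
move=> [sp mp]; split => [w k|t].
  by apply: Ck_add; [exact: Ck_cst|apply: Ck_scale; [exact: sp|exact: Ck_cst]].
apply: (@measurable_borel_comp R R 'rV[R]_n _ (fun t => a + t *: v) _ (mp t)).
move=> s; apply: (@continuousD _ _ _ (fun=> a) (fun t : R => t *: v)).
  exact: cst_continuous.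
exact: scalel_continuous.
Qed.

Fact line_at0 n (a v : 'rV[R]_n) :
  (Mor (@line_plot n a v) : curve (std 'rV[R]_n)) 0 = a.
Proof. by rewrite /= scale0r addr0. Qed.

Lemma std_smooth n (V : normedModType R) (f : mor (std 'rV[R]_n) (std V)) :
  smooth (f : 'rV[R]_n -> V).
Proof.
have si : mixed_smooth (fst : Omega_ R n -> 'rV[R]_n).
  apply: (smooth_mixed (f := id)) => k.
  by apply: (@Ck_linear R k n _ idfun) => y; exact: cvg_id.
have [sf _] := morP f (p := _ : Omega_ R n -> std 'rV[R]_n) si.
exact: sf point.
Qed.

Lemma std_smoothP n (V : normedModType R) (f : 'rV[R]_n -> V) :
  smooth f <-> exists g : mor (std 'rV[R]_n) (std V), f = g.
Proof.
split=> [sf|[g ->]]; last exact: std_smooth.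
have fP m (p : Omega_ R m -> std 'rV[R]_n) :
    plot p -> plot ((f : std 'rV[R]_n -> std V) \o p).
  move=> [sp mp]; split => [w k|t].
    exact: (@Ck_comp _ k m n V f (fun t => p (t, w)) (sf k) (sp w k)).
  exact: (measurable_borel_comp (Ck_continuous (sf 0%N)) (mp t)).
by exists (Mor fP).
Qed.

Lemma std_differentiable n (V : normedModType R)
    (f : mor (std 'rV[R]_n) (std V)) (x : 'rV[R]_n) :
  differentiable (f : 'rV[R]_n -> V) x.
Proof. by have [df _] := std_smooth f 1%N; exact: df. Qed.

Lemma velocity_bij n (a : std 'rV[R]_n) : bijective (@velocity n a).
Proof.
have inj : injective (@velocity n a).
  move=> v w; rewrite -(tclass_repr v) -(tclass_repr w) !velocityE.
  set c := repr v; set d := repr w => e.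
  apply/tclassP; split => [|f]; first by rewrite !curve_at0.
  have E (b : curve_at a) : derive1 (f \o b : R -> R) 0 =
      'd (f : 'rV[R]_n -> R) a (derive1 (b : R -> 'rV[R]_n) 0).
    have db := @curve_differentiable R 'rV[R]_n b 0.
    have df := @std_differentiable n R f (b 0).
    by rewrite (derive1E' (differentiable_comp db df)) (derive1E' db)
      (diff_comp db df) /= curve_at0.
  by rewrite !E e.
pose g u := tclass (CurveAt (line_at0 a u)).
have gK u : velocity (g u) = u.
  rewrite velocityE /=.
  have dl : is_derive (0 : R) 1 (fun t : R => a + t *: u) (0 + u).
    apply: is_deriveD; split; first exact/diff_derivable.
    by rewrite deriveE// diff_val scale1r.
  by rewrite derive1E derive_val add0r.
by exists g => // v; apply: inj; rewrite gK.
Qed.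

Definition cross : sss R :=
  @sub_sss R (std 'rV[R]_2) [set v : 'rV[R]_2 | v 0 0 * v 0 1 = 0].

Definition cross_incl : mor cross (std 'rV[R]_2) :=
  @incl R (std 'rV[R]_2) [set v : 'rV[R]_2 | v 0 0 * v 0 1 = 0].

Fact cross_origin_subproof :
  [set v : 'rV[R]_2 | v 0 0 * v 0 1 = 0] (0 : 'rV[R]_2).
Proof. by rewrite /= !mxE mulr0. Qed.

Definition cross0 : cross := exist _ (0 : 'rV[R]_2) cross_origin_subproof.

End tangent.

(* Main.v *)
Require Import Defs.
From HB Require Import structures.
From mathcomp Require Import all_boot all_order all_algebra generic_quotient.
From mathcomp Require Import all_classical all_reals all_analysis measurable_realfun.
Import Order.TTheory GRing.Theory Num.Theory.
Import numFieldTopology.Exports numFieldNormedType.Exports.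
Local Open Scope classical_set_scope.
Local Open Scope ring_scope.

(** Both quotients are cut out by the numbers (f o c)'(0): a tangent vector is a
base point together with what it does to every function, a cotangent vector is
what a function does to every curve.  Hence the pairing is well defined and
separating almost by construction; what has to be used is that every composite
f o c is differentiable, so that its derivative is linear in f.  Since the
pairing separates cotangent vectors, every identity in the cotangent space may
be checked after pairing with an arbitrary tangent vector, where it becomes an
identity between real numbers.  This gives the vector space axioms and the
linearity of the class map, while the statements about the transpose come down
to the associativity (g o f) o c = g o (f o c).

The cross xy = 0 rests on two observations.  First, every sample-smooth function
f on the cross extends to the plane by
  F (x, y) = f (x, 0) + f (0, y) - f (0, 0),
because one of the two coordinates of a point of the cross vanishes
([cross_smfun_extends]).  A morphism along which all functions extend has an
injective differential: two tangent vectors with the same image pair equally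
with all classes [F o iota], that is with everything ([differential_inj]).
Second, a plane curve (c1, c2) through the origin with c1 c2 = 0 satisfies
c1'(0) c2'(0) = 0, as a limit of products of difference quotients which all
vanish ([derive1_mul_eq0]).  So velocities lie on the axes, and the lines
t |-> t u realise every vector of the axes ([range_velocity_cross]).

A linear structure on the tangent space of the cross making the pairing linear
would contain the sum of the two unit axis vectors.  Its pairings with the
classes of the two coordinate functions, which are the coordinates of its
velocity, would both be 1, although no velocity has two nonzero coordinates. *)

(** * The pairing at a point *)

Section duality.
Set Implicit Arguments.
Unset Strict Implicit.
Variable R : realType.

Lemma smfun_curve_derivable (X : sss R) (c : curve X) (f : smfun X) (t : R) :
  derivable (f \o c : R -> R) t 1.
Proof. exact/diff_derivable/(curve_differentiable (mor_comp f c)). Qed.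

(** The analytic input to the vector space structure of the cotangent space:
the derivative along a curve is linear because f o c and g o c are both
differentiable. *)
Lemma derive1_smfun_linear (X : sss R) (c : curve X) (a : R) (f g : smfun X) :
  derive1 ((a *: f + g : smfun X) \o c : R -> R) 0 =
  a * derive1 (f \o c : R -> R) 0 + derive1 (g \o c : R -> R) 0.
Proof.
have df := @smfun_curve_derivable _ c f 0.
have dg := @smfun_curve_derivable _ c g 0.
rewrite !derive1E -[LHS]/('D_1 (a \*: (f \o c : R -> R) + (g \o c : R -> R)) 0).
by rewrite deriveD ?deriveZ//; exact: derivableZ.
Qed.

Section at_point.
Variables (X : sss R) (x : X).

Lemma cotclassP (f g : smfun X) :
  (forall c : curve X, c 0 = x ->
     derive1 (f \o c : R -> R) 0 = derive1 (g \o c : R -> R) 0) <->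
  cotclass x f = cotclass x g.
Proof.
split=> [fg|/eqmodP/asboolP //].
by apply/eqmodP/asboolP.
Qed.

Lemma cotclass_repr (phi : cotangent x) : cotclass x (repr phi) = phi.
Proof. exact: reprK. Qed.

(** The pairing is computed on chosen representatives; changing the function is
harmless along any curve through x, and changing the curve is harmless for any
function. *)
Lemma pairingE (c : curve_at x) (f : smfun X) :
  pairing (tclass c) (cotclass x f) = derive1 (f \o c : R -> R) 0.
Proof.
have /tclassP[_ rc] := tclass_repr (tclass c).
have /cotclassP rf := cotclass_repr (cotclass x f).
by rewrite /pairing rf ?curve_at0.
Qed.

Lemma pairing_inj_tangent (v w : tangent x) :
  (forall phi : cotangent x, pairing v phi = pairing w phi) -> v = w.
Proof.
rewrite -(tclass_repr v) -(tclass_repr w) => vw.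
apply/tclassP; split=> [|f]; first by rewrite !curve_at0.
by rewrite -!pairingE.
Qed.

Lemma pairing_inj_cotangent (phi psi : cotangent x) :
  (forall v : tangent x, pairing v phi = pairing v psi) -> phi = psi.
Proof.
rewrite -(cotclass_repr phi) -(cotclass_repr psi) => pp.
apply/cotclassP => c cx.
by have := pp (tclass (CurveAt cx)); rewrite !pairingE.
Qed.

Lemma pairing_tscale (a : R) (v : tangent x) (phi : cotangent x) :
  pairing (tscale a v) phi = a * pairing v phi.
Proof.
rewrite -(tclass_repr v) -(cotclass_repr phi) tscaleE !pairingE.
exact: (curve_rescale (mor_comp (repr phi) (repr v)) a).
Qed.

(** * The vector space structure of the cotangent space *)

Definition cot_zero : cotangent x := cotclass x 0.
Definition cot_add (phi psi : cotangent x) : cotangent x :=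
  cotclass x (repr phi + repr psi).
Definition cot_scale (a : R) (phi : cotangent x) : cotangent x :=
  cotclass x (a *: repr phi).
Definition cot_opp (phi : cotangent x) : cotangent x := cot_scale (-1) phi.

(** The three lemmas on [pairing v] turn every vector space axiom of the
cotangent space into the same axiom in R, by separation. *)
Lemma pairing_cot_scale v a phi :
  pairing v (cot_scale a phi) = a * pairing v phi.
Proof.
rewrite -(tclass_repr v) -[in RHS](cotclass_repr phi) !pairingE -[a *: _]addr0.
rewrite derive1_smfun_linear.
have -> : derive1 ((0 : smfun X) \o repr v : R -> R) 0 = 0 by exact: derive1_cst.
by rewrite addr0.
Qed.

Lemma pairing_cot_add v phi psi :
  pairing v (cot_add phi psi) = pairing v phi + pairing v psi.
Proof.
rewrite -(tclass_repr v) -[in RHS](cotclass_repr phi).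
rewrite -[in RHS](cotclass_repr psi) !pairingE -[X in X + _]scale1r.
by rewrite derive1_smfun_linear mul1r.
Qed.

Lemma pairing_cot_zero v : pairing v cot_zero = 0.
Proof. by rewrite -(tclass_repr v) pairingE; exact: derive1_cst. Qed.

Let pairingE' := (pairing_cot_scale, pairing_cot_add, pairing_cot_zero).

Fact cot_addA : associative cot_add.
Proof. by move=> *; apply: pairing_inj_cotangent => v; rewrite !pairingE' addrA. Qed.
Fact cot_addC : commutative cot_add.
Proof. by move=> *; apply: pairing_inj_cotangent => v; rewrite !pairingE' addrC. Qed.
Fact cot_add0 : left_id cot_zero cot_add.
Proof. by move=> *; apply: pairing_inj_cotangent => v; rewrite !pairingE' add0r. Qed.
Fact cot_addN : left_inverse cot_zero cot_opp cot_add.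
Proof.
by move=> *; apply: pairing_inj_cotangent => v; rewrite !pairingE' mulN1r addNr.
Qed.

HB.instance Definition _ :=
  GRing.isZmodule.Build (cotangent x) cot_addA cot_addC cot_add0 cot_addN.

Fact cot_scaleA a b phi : cot_scale a (cot_scale b phi) = cot_scale (a * b) phi.
Proof. by apply: pairing_inj_cotangent => v; rewrite !pairingE' mulrA. Qed.
Fact cot_scale1 : left_id 1 cot_scale.
Proof. by move=> *; apply: pairing_inj_cotangent => v; rewrite !pairingE' mul1r. Qed.
Fact cot_scaleDr : right_distributive cot_scale +%R.
Proof. by move=> *; apply: pairing_inj_cotangent => v; rewrite !pairingE' mulrDr. Qed.
Fact cot_scaleDl phi : {morph cot_scale^~ phi : a b / a + b}.
Proof. by move=> *; apply: pairing_inj_cotangent => v; rewrite !pairingE' mulrDl. Qed.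

HB.instance Definition _ := GRing.Zmodule_isLmodule.Build R (cotangent x)
  cot_scaleA cot_scale1 cot_scaleDr cot_scaleDl.

Lemma cotangent_induced_lmodule :
  exists L : GRing.Lmodule R (cotangent x), induced_lmodule L.
Proof.
exists (GRing.Lmodule.class (cotangent x : lmodType R)) => a f g.
apply: pairing_inj_cotangent => v.
rewrite -[RHS]/(pairing v (cot_add (cot_scale a (cotclass x f)) (cotclass x g))).
by rewrite !pairingE' -(tclass_repr v) !pairingE derive1_smfun_linear.
Qed.

End at_point.

(** * Differential and transpose *)

Section transpose.
Variables (X Y : sss R) (f : mor X Y) (x : X).

Lemma transposeE (g : smfun Y) :
  transpose (cotclass (f x) g) = cotclass x (pull f g).
Proof.
apply/cotclassP => c cx.
have /cotclassP rg := cotclass_repr (cotclass (f x) g).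
by apply: (rg (mor_comp f c)); rewrite /= cx.
Qed.

Lemma transpose_linear (LX : GRing.Lmodule R (cotangent x))
    (LY : GRing.Lmodule R (cotangent (f x))) :
  induced_lmodule LX -> induced_lmodule LY ->
  linear (@transpose R X Y f x
            : GRing.Lmodule.Pack LY -> GRing.Lmodule.Pack LX).
Proof.
move=> linX linY a phi psi.
rewrite -(cotclass_repr phi) -(cotclass_repr psi) -linY !transposeE.
by rewrite -linX; congr cotclass; exact: mor_ext.
Qed.

Lemma pairing_differential (v : tangent x) (psi : cotangent (f x)) :
  pairing (differential f v) psi = pairing v (transpose psi).
Proof.
by rewrite -(tclass_repr v) -(cotclass_repr psi) differentialE transposeE !pairingE.
Qed.

(** Extension of functions along f makes the transpose surjective, and by the
adjunction the differential of f then forgets nothing that the pairing sees. *)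
Lemma differential_inj :
  (forall g : smfun X, exists h : smfun Y, g = pull f h) ->
  injective (@differential R X Y f x).
Proof.
move=> ext v w vw; apply: pairing_inj_tangent => phi.
have [h hE] := ext (repr phi).
by rewrite -(cotclass_repr phi) hE -transposeE -!pairing_differential vw.
Qed.

End transpose.

(** * The cross *)

(** As f and g vanish at t, the product of their difference quotients at t is
the quotient of f g = 0 by the square of the increment, and it converges to the
product of the two derivatives. *)
Lemma derive1_mul_eq0 (f g : R -> R) (t : R) :
  derivable f t 1 -> derivable g t 1 -> f t = 0 -> g t = 0 ->
  (forall s, f s * g s = 0) -> derive1 f t * derive1 g t = 0.
Proof.
move=> df dg ft gt fg; rewrite !derive1E.
have q0 : (fun h : R => h^-1 *: (f (h *: (1 : R) + t) - f t) *
    (h^-1 *: (g (h *: (1 : R) + t) - g t))) = fun=> 0.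
  apply/funext => h.
  by rewrite ft gt !subr0 -scalerAl -scalerAr fg !scaler0.
have qc : (fun=> 0 : R) h @[h --> (0 : R)^'] --> 'D_1 f t * 'D_1 g t.
  by rewrite -q0; exact: (cvgM df dg).
by rewrite -(cvg_lim (@Rhausdorff R) qc) lim_cst.
Qed.

Fact cross_scale_closed (u : 'rV[R]_2) : u 0 0 * u 0 1 = 0 -> forall t : R,
  [set v : 'rV[R]_2 | v 0 0 * v 0 1 = 0] (t *: u).
Proof. by move=> uX t /=; rewrite !mxE mulrACA uX mulr0. Qed.

Fact cross_line_plot (u : 'rV[R]_2) (uX : u 0 0 * u 0 1 = 0) n
    (p : Omega_ R n -> std R) :
  plot p ->
  plot ((fun t : std R => exist _ (t *: u) (cross_scale_closed uX t) : cross R) \o p).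
Proof.
move=> pp; have := line_plot 0 u pp.
by congr plot; apply/funext => z /=; rewrite add0r.
Qed.

Definition cross_line (u : 'rV[R]_2) (uX : u 0 0 * u 0 1 = 0) : curve (cross R) :=
  Mor (@cross_line_plot u uX).

Fact cross_line0 (u : 'rV[R]_2) (uX : u 0 0 * u 0 1 = 0) :
  cross_line uX 0 = cross0 R.
Proof. by apply/eq_exist; rewrite scale0r. Qed.

Definition cross_tangent (u : 'rV[R]_2) (uX : u 0 0 * u 0 1 = 0) :
  tangent (cross0 R) := tclass (CurveAt (cross_line0 uX)).

Lemma cross_axis (i : 'I_2) :
  (delta_mx 0 i : 'rV[R]_2) 0 0 * (delta_mx 0 i : 'rV[R]_2) 0 1 = 0.
Proof. by rewrite !mxE; case: i => -[|[|//]] => /=; rewrite ?mulr0 ?mul0r. Qed.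

(** The sum of the restrictions to the two axes counts the value at the origin
twice on the cross, whence the correction term; each restriction is smooth on
the plane since it is f along an axis composed with a coordinate. *)
Lemma cross_smfun_extends (f : smfun (cross R)) :
  exists F : smfun (std 'rV[R]_2), f = pull (cross_incl R) F.
Proof.
pose fr (i : 'I_2) : smfun (std 'rV[R]_2) :=
  mor_comp (mor_comp f (cross_line (cross_axis i))) (coord_fun R i).
pose cst0 : smfun (std 'rV[R]_2) :=
  @Mor R (std 'rV[R]_2) (std R) (fun=> f (cross0 R))
    (fun n p _ => @plot_cst R (std R) n (f (cross0 R))).
exists (fr 0 + fr 1 - cst0); apply: mor_ext => -[v vX].
have line_of i (t : R) :
    v = t *: delta_mx 0 i -> cross_line (cross_axis i) t = exist _ v vX.
  by move=> vt; exact/eq_exist/esym.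
have v_sum : v = v 0 0 *: delta_mx 0 0 + v 0 1 *: delta_mx 0 1.
  by rewrite [LHS]row_sum_delta big_ord_recl big_ord1; congr (_ + _ *: delta_mx _ _);
     [congr (v _ _)|]; exact: val_inj.
rewrite -[RHS]/((f (cross_line (cross_axis 0) (v 0 0)) : R) +
  f (cross_line (cross_axis 1) (v 0 1)) + -1 * (f (cross0 R) : R)) mulN1r.
have /eqP := vX; rewrite mulf_eq0 => /orP[] /eqP v0.
  have -> : cross_line (cross_axis 1) (v 0 1) = exist _ v vX.
    by apply: line_of; rewrite {1}v_sum v0 scale0r add0r.
  by rewrite v0 cross_line0 addrAC subrr add0r.
have -> : cross_line (cross_axis 0) (v 0 0) = exist _ v vX.
  by apply: line_of; rewrite {1}v_sum v0 scale0r addr0.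
by rewrite v0 cross_line0 addrK.
Qed.

(** A curve in the cross has coordinates with product 0, both vanishing at time
0, so that its velocity cannot leave the axes. *)
Lemma velocity_cross (v : tangent (cross0 R)) :
  let u := velocity (differential (cross_incl R) v) in u 0 0 * u 0 1 = 0.
Proof.
rewrite -(tclass_repr v); set c := repr v.
rewrite /= differentialE velocityE.
have coordE i : derive1 (push_curve (cross_incl R) c : R -> 'rV[R]_2) 0 0 i =
    derive1 (fun t : R => (cross_incl R (c t) : 'rV[R]_2) 0 i) 0.
  exact/esym/(curve_lin (mor_comp (cross_incl R) c)
    (@coord_lin_continuous R 2 i)).
have dc i : derivable (fun t : R => (cross_incl R (c t) : 'rV[R]_2) 0 i) 0 1.
  exact: (@smfun_curve_derivable _ c (pull (cross_incl R) (coord_fun R i)) 0).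
rewrite !coordE; apply: derive1_mul_eq0 => //.
- by rewrite curve_at0 mxE.
- by rewrite curve_at0 mxE.
- by move=> s; exact: (svalP (c s)).
Qed.

Lemma velocity_cross_tangent (u : 'rV[R]_2) (uX : u 0 0 * u 0 1 = 0) :
  velocity (differential (cross_incl R) (cross_tangent uX)) = u.
Proof.
rewrite differentialE velocityE /=.
have dl : is_derive (0 : R) 1 (fun t : R => t *: u) u.
  by split; [exact/diff_derivable | rewrite deriveE// diff_val scale1r].
by rewrite derive1E derive_val.
Qed.

Lemma range_velocity_cross :
  [set velocity (differential (cross_incl R) v) | v in [set: tangent (cross0 R)]] =
  [set u : 'rV[R]_2 | u 0 0 * u 0 1 = 0].
Proof.
apply/seteqP; split=> [_ [v _ <-]|u uX]; first exact: velocity_cross.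
by exists (cross_tangent uX) => //; exact: velocity_cross_tangent.
Qed.

(** The coordinate functions, restricted to the cross, detect the velocity: this
is how linearity of the pairing constrains velocities. *)
Lemma pairing_cross_coord (v : tangent (cross0 R)) i :
  pairing v (cotclass _ (pull (cross_incl R) (coord_fun R i))) =
  velocity (differential (cross_incl R) v) 0 i.
Proof.
rewrite -(tclass_repr v) pairingE differentialE velocityE.
exact: (curve_lin (mor_comp (cross_incl R) (repr v))
  (@coord_lin_continuous R 2 i)).
Qed.

Lemma cross_axis_sum :
  let u : 'rV[R]_2 := delta_mx 0 0 + delta_mx 0 1 in u 0 0 * u 0 1 <> 0.
Proof.
by rewrite /= !mxE /= addr0 add0r mulr1; apply/eqP; exact: oner_neq0.
Qed.

(** The sum of the two unit axis vectors would have both coordinates of its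
velocity equal to 1. *)
Lemma cross_pairing_not_linear (L : GRing.Lmodule R (tangent (cross0 R))) :
  ~ forall phi : cotangent (cross0 R),
      scalar (fun v : GRing.Lmodule.Pack L => pairing v phi).
Proof.
move=> lin; apply: cross_axis_sum.
pose T := GRing.Lmodule.Pack L.
(* The factor 1 gives the sum the shape a *: u + v in which linearity is stated. *)
pose v : T := 1 *: (cross_tangent (cross_axis 0) : T) + cross_tangent (cross_axis 1).
(* Every velocity lies on the axes, so it suffices that v has velocity (1, 1). *)
suff <- : velocity (differential (cross_incl R) (v : tangent (cross0 R))) =
    delta_mx 0 0 + delta_mx 0 1 by exact: velocity_cross.
apply/rowP => i; rewrite -pairing_cross_coord lin mul1r.
by rewrite [RHS]mxE !pairing_cross_coord !velocity_cross_tangent.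
Qed.

End duality.

Theorem proposition4p38 (R : realType) :
  (forall (X : sss R) (x : X),
    [/\ exists L : GRing.Lmodule R (cotangent x), induced_lmodule L,
        forall (c : curve_at x) (f : smfun X),
          derivable (f \o c : R -> R) 0 1 /\
          pairing (tclass c) (cotclass x f) = derive1 (f \o c : R -> R) 0,
        forall v w : tangent x,
          (forall phi : cotangent x, pairing v phi = pairing w phi) -> v = w,
        forall phi psi : cotangent x,
          (forall v : tangent x, pairing v phi = pairing v psi) -> phi = psi &
        forall (a : R) (v : tangent x) (phi : cotangent x),
          pairing (tscale a v) phi = a * pairing v phi])
  /\
  (forall (X Y : sss R) (f : mor X Y) (x : X),
    [/\ forall g : smfun Y,
          transpose (cotclass (f x) g) = cotclass x (pull f g),
        forall (LX : GRing.Lmodule R (cotangent x))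
               (LY : GRing.Lmodule R (cotangent (f x))),
          induced_lmodule LX -> induced_lmodule LY ->
          linear (@transpose R X Y f x
                    : GRing.Lmodule.Pack LY -> GRing.Lmodule.Pack LX) &
        forall (v : tangent x) (psi : cotangent (f x)),
          pairing (differential f v) psi = pairing v (transpose psi)])
  /\
  ~ (exists L : GRing.Lmodule R (tangent (cross0 R)),
       forall phi : cotangent (cross0 R),
         scalar (fun v : GRing.Lmodule.Pack L => pairing v phi))
  /\
  let d_incl : tangent (cross0 R) -> tangent (cross_incl R (cross0 R)) :=
    differential (cross_incl R) (x := cross0 R) in
  let image : set 'rV[R]_2 := [set velocity (d_incl v) | v in setT] in
  [/\ injective d_incl,
      image = [set u : 'rV[R]_2 | u 0 1 = 0] `|` [set u : 'rV[R]_2 | u 0 0 = 0],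
      forall (a : R) (u : 'rV[R]_2), image u -> image (a *: u) &
      ~ exists U : {vspace 'rV[R]_2}, image = [set u : 'rV[R]_2 | u \in U]].
Proof.
split; first move=> X x.
  split; [exact: cotangent_induced_lmodule| |exact: pairing_inj_tangent|
    exact: pairing_inj_cotangent|exact: pairing_tscale].
  by move=> c f; split; [exact: smfun_curve_derivable|exact: pairingE].
split=> [X Y f x|].
  split; [exact: transposeE|exact: transpose_linear|exact: pairing_differential].
split=> [[L]|d_incl image]; first exact: cross_pairing_not_linear.
have imageE : image = [set u | u 0 0 * u 0 1 = 0] := range_velocity_cross R.
split; first exact: (differential_inj (@cross_smfun_extends R)).
- rewrite imageE; apply/seteqP; split=> u /=.
    by move=> /eqP; rewrite mulf_eq0 orbC => /orP[] /eqP; [left|right].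
  by move=> [] ->; rewrite ?mulr0 ?mul0r.
- by rewrite imageE => a u uX; exact: (cross_scale_closed uX).
- rewrite imageE => -[U crossU].
  have memU u : u \in U <-> u 0 0 * u 0 1 = 0.
    by have /seteqP[XU UX] := crossU; split=> [/UX|/XU].
  apply: (@cross_axis_sum R); apply/memU.
  by apply: rpredD; apply/memU; exact: cross_axis.
Qed.
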